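(* Let $k<n$ be positive integers and let $B^n=\{(x_1,\dots,x_n)\in\mathbb R^n:x_i\in\{0,1\}\text{ for each }1\le i\le n\}$. Then for any $k$-dimensional affine subspace $\Gamma\subset\mathbb R^n$, $$\#\left\{a\in B^n:\min_{b\in\Gamma}\|a-b\|_2<\tfrac14\,n^{-1/2}(n-k)^{-1/2}\right\}\le2^{k+1}.$$
   Context: $\|\cdot\|_2$ is the Euclidean norm on $\mathbb R^n$. *)

(* Defs.v *)
From mathcomp Require Export all_boot all_order all_algebra.
From mathcomp Require Export all_classical all_reals all_analysis.
From mathcomp Require Import zify.

Set Implicit Arguments.
Unset Strict Implicit.
Unset Printing Implicit Defensive.

Export Order.TTheory GRing.Theory Num.Theory.

Local Open Scope classical_set_scope.
Local Open Scope ring_scope.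

(* The library norm `|x| on 'rV[R]_n is the sup norm, hence a separate
   Euclidean norm. *)
Definition l2norm (R : realType) (n : nat) (x : 'rV[R]_n) : R :=
  Num.sqrt (\sum_(i < n) x 0 i ^+ 2).

Definition cube (R : realType) (n : nat) : set 'rV[R]_n :=
  [set x | forall i : 'I_n, x 0 i = 0 \/ x 0 i = 1].

Definition affine_subspace (R : realType) (n k : nat) (G : set 'rV[R]_n) :
    Prop :=
  exists (p : 'rV[R]_n) (V : {vspace 'rV[R]_n}),
    \dim V = k /\ G = [set p + v | v in [set v | v \in V]].

(* On an affine subspace this infimum is a minimum: see [l2dist_attained]. *)
Definition l2dist (R : realType) (n : nat) (a : 'rV[R]_n) (G : set 'rV[R]_n) :
    R :=
  inf [set l2norm (a - b) | b in G].

Section attained.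
Variable R : realType.

Let dot n (x y : 'rV[R]_n) : R := (x *m y^T) 0 0.

Let dotE n (x y : 'rV[R]_n) : dot x y = \sum_(i < n) x 0 i * y 0 i.
Proof. by rewrite /dot mxE; apply: eq_bigr => i _; rewrite mxE. Qed.

Let dotxx n (x : 'rV[R]_n) : dot x x = \sum_(i < n) x 0 i ^+ 2.
Proof. by rewrite dotE; apply: eq_bigr => i _; rewrite expr2. Qed.

Let dot_eq0 n (x : 'rV[R]_n) : dot x x = 0 -> x = 0.
Proof.
rewrite dotxx => /eqP; rewrite psumr_eq0 => [|i _]; last exact: sqr_ge0.
move=> /allP x0; apply/rowP => i; rewrite mxE; apply/eqP.
by rewrite -sqrf_eq0; apply: x0; rewrite mem_index_enum.
Qed.

Let normal_equations m n (A : 'M[R]_(m, n)) (w : 'rV[R]_n) :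
  exists u : 'rV[R]_m, (w - u *m A) *m A^T = 0.
Proof.
have sub : (A *m A^T <= A^T)%MS by exact: submxMl.
have ker : (kermx (A *m A^T) <= kermx A)%MS.
  apply/row_subP => i; apply/sub_kermxP; apply: dot_eq0.
  have : row i (kermx (A *m A^T)) *m (A *m A^T) = 0.
    by apply/sub_kermxP; exact: row_sub.
  by move=> e; rewrite /dot trmx_mul mulmxA -(mulmxA _ A) e mul0mx mxE.
have rk : (\rank A^T <= \rank (A *m A^T))%N.
  have := mxrankS ker; rewrite !mxrank_ker mxrank_tr.
  have := rank_leq_row A; have := rank_leq_row (A *m A^T).
  by lia.
have eqA : (A^T <= A *m A^T)%MS by rewrite -(geq_leqif (mxrank_leqif_sup sub)).
have /submxP[u uE] : (w *m A^T <= A *m A^T)%MS.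
  exact: submx_trans (submxMl _ _) eqA.
by exists u; rewrite mulmxBl uE mulmxA subrr.
Qed.

Lemma l2dist_attained n k (G : set 'rV[R]_n) (a : 'rV[R]_n) :
  affine_subspace k G ->
  exists2 b, G b & l2dist a G = l2norm (a - b) /\
    forall c, G c -> l2norm (a - b) <= l2norm (a - c).
Proof.
move=> [p [V [_ ->]]].
pose A : 'M[R]_(\dim V, n) := \matrix_(i < \dim V) (vbasis V)`_i.
have AV (u : 'rV_(\dim V)) : u *m A \in V.
  rewrite mulmx_sum_row; apply: memv_suml => i _; rewrite rowK memvZ //.
  by apply: vbasis_mem; rewrite mem_nth // size_tuple.
have VA v : v \in V -> exists u, v = u *m A.
  move=> vV; exists (\row_i coord (vbasis V) i v).
  rewrite {1}(coord_vbasis vV) mulmx_sum_row.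
  by apply: eq_bigr => i _; rewrite rowK mxE.
have [u orth] := normal_equations A (a - p).
set b := p + u *m A.
have Gb : [set p + v | v in [set v | v \in V]] b by exists (u *m A) => //=.
have min c : [set p + v | v in [set v | v \in V]] c ->
    l2norm (a - b) <= l2norm (a - c).
  case=> v /= /VA[u' ->] <-; rewrite /l2norm ler_wsqrtr // -!dotxx.
  set r := a - b; set d := (u - u') *m A.
  have -> : a - (p + u' *m A) = r + d.
    by rewrite /r /d /b mulmxBl !opprD !addrA subrK.
  have rd : dot r d = 0.
    rewrite /dot /d trmx_mul mulmxA.
    by rewrite /r /b opprD addrA orth mul0mx mxE.
  have dr : dot d r = 0.
    by rewrite -[RHS]rd !dotE; apply: eq_bigr => i _; rewrite mulrC.
  clearbody r d.
  have -> : dot (r + d) (r + d) = dot r r + dot d d.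
    have dD (x y z : 'rV[R]_n) : dot x (y + z) = dot x y + dot x z.
      by rewrite /dot linearD /= mulmxDr mxE.
    have Dd (x y z : 'rV[R]_n) : dot (x + y) z = dot x z + dot y z.
      by rewrite /dot mulmxDl mxE.
    by rewrite dD !Dd rd dr addr0 add0r.
  by rewrite lerDl dotxx sumr_ge0 // => i _; exact: sqr_ge0.
exists b => //; split => //; apply/eqP; rewrite eq_le; apply/andP; split.
  apply: ge_inf; last by exists b.
  by exists 0 => _ [c _ <-]; exact: sqrtr_ge0.
apply: lb_le_inf; first by exists (l2norm (a - b)), b.
by move=> _ [c Gc <-]; exact: min.
Qed.

End attained.

(* Main.v *)
Require Import Defs.
From mathcomp Require Import ring lra.

(** Write [Gamma = p + V] with [dim V = k].  The points counted are determined
    by [k] of their coordinates, which gives even the bound [2 ^ k].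

    The [k] coordinates are those of a [k x k] minor of maximal absolute value
    in a basis matrix of [V].  By Cramer's rule every coordinate of a vector
    [v] of [V] is a linear combination of the selected ones whose coefficients
    are quotients of two minors, the denominator being the maximal one, so that
    they lie in [[-1, 1]] ([dominating_coordinates]).

    Now let [a] and [a'] be counted points, [b] and [b'] their nearest points
    of [Gamma], and suppose that [a] and [a'] agree on the selected
    coordinates.  Put [d = a - a'], [v = b - b'], a vector of [V], and
    [e = d - v].  On the selected coordinates [d] vanishes, so [v = - e] there,
    and for every other coordinate [j]
    [|d_j| <= |e_j| + |v_j| <= |e_j| + sum |e_i|], with [i] ranging over the
    selected coordinates: [d_j] is bounded by the l1 norm of [e]
    ([coord_le_l1norm_sub]).  By Cauchy-Schwarz the l1 norm is at most [sqrt n]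
    times the Euclidean one, and the Euclidean distance of a counted point to
    [Gamma] is below [1 / (4 sqrt n)], whence [|d_j| <= 1/2].  As [d_j] is a
    difference of two elements of [{0, 1}], it vanishes. *)

Local Open Scope classical_set_scope.
Local Open Scope ring_scope.
Local Open Scope card_scope.

(** This is Cramer's rule for [colsub f A] and the right-hand side [col j A].
    Replacing column [i] of [colsub f A] by [col j A] does not change the
    cofactors along that column, so the left-hand side is the Laplace expansion
    of the determinant along it. *)
Lemma adj_colsub_mul_col (R : comNzRingType) (k n : nat) (A : 'M[R]_(k, n))
    (f : {ffun 'I_k -> 'I_n}) (i : 'I_k) (j : 'I_n) :
  (\adj (colsub f A) *m col j A) i 0 =
  \det (colsub [ffun l => if l == i then j else f l] A).
Proof.
rewrite mxE (expand_det_col _ i); apply: eq_bigr => l _.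
rewrite !mxE ffunE eqxx mulrC; congr (_ * _).
rewrite /cofactor; congr (_ * \det _); apply/matrixP => x y.
by rewrite !mxE ffunE eq_sym (negPf (neq_lift _ _)).
Qed.

Lemma det_colsub_neq0_inj (R : comNzRingType) (k n : nat) (A : 'M[R]_(k, n))
    (f : 'I_k -> 'I_n) : \det (colsub f A) != 0 -> injective f.
Proof.
move=> detN0 x y fxy; apply/eqP; apply: contraNT detN0 => xy.
rewrite -det_tr; apply/eqP; apply: (determinant_alternate xy) => z.
by rewrite !mxE fxy.
Qed.

Lemma row_free_colsub_det_neq0 (F : fieldType) (k n : nat) (A : 'M[F]_(k, n)) :
  row_free A -> exists f : {ffun 'I_k -> 'I_n}, \det (colsub f A) != 0.
Proof.
move=> freeA; have fullA : row_full A^T by rewrite /row_full mxrank_tr.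
exists [ffun i => fullrankfun fullA i].
have := fullrowsub_unit fullA.
rewrite unitmxE unitfE -det_tr.
suff -> : (rowsub (fullrankfun fullA) A^T)^T =
    colsub [ffun i => fullrankfun fullA i] A by [].
by apply/matrixP => x y; rewrite !mxE ffunE.
Qed.

(** A selection of columns with maximal minor works: Cramer's rule expresses the
    [j]-th coordinate with minors as coefficients. *)
Lemma dominating_coordinates (R : realFieldType) (k n : nat)
    (A : 'M[R]_(k, n)) : row_free A ->
  exists2 f : 'I_k -> 'I_n, injective f &
    forall (u : 'rV_k) (j : 'I_n),
      `|(u *m A) 0 j| <= \sum_i `|(u *m A) 0 (f i)|.
Proof.
move=> /row_free_colsub_det_neq0 [f0 f0N0].
pose minor (f : {ffun 'I_k -> 'I_n}) := `|\det (colsub f A)|.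
case: (@Order.TotalTheory.arg_maxP _ _ _ f0 xpredT minor) => // f _ fmax.
set M := colsub f A in fmax *.
have detN0 : 0 < `|\det M|.
  by apply: lt_le_trans (fmax f0 isT); rewrite normr_gt0.
exists f; first by apply: (det_colsub_neq0_inj _ _ _ A); rewrite -normr_gt0.
move=> u j; rewrite -(ler_pM2l detN0) -normrM.
have -> : \det M * (u *m A) 0 j =
    \sum_i (u *m A) 0 (f i) * (\adj M *m col j A) i 0.
  have -> : \det M * (u *m A) 0 j = (u *m M *m (\adj M *m col j A)) 0 0.
    rewrite mulmxA -(mulmxA u) mul_mx_adj mul_mx_scalar -scalemxAl [in RHS]mxE.
    by congr (_ * _); rewrite !mxE; apply: eq_bigr => l _; rewrite mxE.
  rewrite mxE; apply: eq_bigr => i _; congr (_ * _).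
  by rewrite !mxE; apply: eq_bigr => l _; rewrite mxE.
apply: le_trans (ler_norm_sum _ _ _) _; rewrite mulr_sumr.
apply: ler_sum => i _; rewrite normrM mulrC adj_colsub_mul_col.
by apply: ler_wpM2r => //; exact: fmax.
Qed.

Lemma vspace_dominating_coordinates (R : realFieldType) (n : nat)
    (V : {vspace 'rV[R]_n}) :
  exists2 f : 'I_(\dim V) -> 'I_n, injective f &
    forall v, v \in V -> forall j, `|v 0 j| <= \sum_i `|v 0 (f i)|.
Proof.
pose A : 'M[R]_(\dim V, n) := \matrix_(i < \dim V) (vbasis V)`_i.
have uA (u : 'rV_(\dim V)) : u *m A = \sum_i u 0 i *: (vbasis V)`_i.
  by rewrite mulmx_sum_row; apply: eq_bigr => i _; rewrite rowK.
have freeA : row_free A.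
  rewrite -kermx_eq0; apply/eqP/row_matrixP => i; rewrite row0.
  have /sub_kermxP : (row i (kermx A) <= kermx A)%MS by exact: row_sub.
  rewrite uA => /(freeP (basis_free (vbasisP V))) u0.
  by apply/rowP => l; rewrite u0 mxE.
have [f f_inj fP] := dominating_coordinates _ _ _ _ freeA.
exists f => // v vV j.
have -> : v = (\row_i coord (vbasis V) i v) *m A.
  by rewrite uA {1}(coord_vbasis vV); apply: eq_bigr => i _; rewrite mxE.
exact: fP.
Qed.

(** The selected coordinates and [j] are distinct, so every coordinate of
    [d - v] is used at most once in the bound [|d_j - v_j| + sum |v_(f i)|]. *)
Lemma coord_le_l1norm_sub (R : realDomainType) (k n : nat)
    (f : 'I_k -> 'I_n) (d v : 'rV[R]_n) : injective f ->
  (forall i, d 0 (f i) = 0) ->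
  (forall j, `|v 0 j| <= \sum_i `|v 0 (f i)|) ->
  forall j, `|d 0 j| <= \sum_i `|(d - v) 0 i|.
Proof.
move=> f_inj d0 vf j.
have [/imsetP[i _ ->]|jNf] := boolP (j \in [set f i | i in 'I_k]%SET).
  by rewrite d0 normr0 sumr_ge0.
have -> : d 0 j = (d - v) 0 j + v 0 j by rewrite !mxE subrK.
apply: le_trans (ler_normD _ _) _; rewrite (bigD1 j) //= lerD2l.
apply: le_trans (vf j) _.
have -> : \sum_i `|v 0 (f i)| =
    \sum_(m in [set f i | i in 'I_k]%SET) `|(d - v) 0 m|.
  rewrite big_imset /=; last by move=> x y _ _; exact: f_inj.
  by apply: eq_bigr => i _; rewrite !mxE d0 sub0r normrN.
rewrite big_mkcond [leRHS]big_mkcond; apply: ler_sum => m _.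
case: ifP => [mf|_]; last by case: ifP.
by rewrite ifT //; apply: contraNneq jNf => <-.
Qed.

Lemma l1norm_le_l2norm (R : realType) (n : nat) (x : 'rV[R]_n) :
  \sum_i `|x 0 i| <= Num.sqrt n%:R * l2norm x.
Proof.
rewrite /l2norm -sqrtrM // -[leLHS]ger0_norm ?sumr_ge0 // -sqrtr_sqr.
apply: ler_wsqrtr.
set S := \sum_i `|x 0 i|; set Q := \sum_i x 0 i ^+ 2.
case: n x @S @Q => [|n] x S Q; first by rewrite /S big_ord0 expr0n mul0r.
(* This sum is the square of the dimension times the sum of the squared
   deviations of the |x_i| from their mean: its nonnegativity is the Cauchy-Schwarz inequality against (1, .., 1). *)
have : 0 <= \sum_i (n.+1%:R * `|x 0 i| - S) ^+ 2.
  by apply: sumr_ge0 => i _; exact: sqr_ge0.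
have -> : \sum_i (n.+1%:R * `|x 0 i| - S) ^+ 2 =
    n.+1%:R * (n.+1%:R * Q - S ^+ 2).
  under eq_bigr => i _ do rewrite sqrrB exprMn real_normK ?num_real //.
  rewrite big_split /= sumr_const card_ord sumrB -mulr_sumr -/Q.
  rewrite (eq_bigr (fun i => (n.+1%:R * S *+ 2) * `|x 0 i|)); last first.
    by move=> i _; rewrite mulrAC -!mulrnAl.
  rewrite -mulr_sumr -/S -[S ^+ 2 *+ _]mulr_natl.
  by ring.
by rewrite pmulr_rge0 ?ltr0n // subr_ge0.
Qed.

Lemma radius_le (R : realType) (n m : nat) : (0 < n)%N -> (0 < m)%N ->
  4^-1 * n%:R `^ (- 2^-1) * m%:R `^ (- 2^-1) <= (4 * Num.sqrt n%:R)^-1 :> R.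
Proof.
move=> n0 m0; rewrite !powRN !powR12_sqrt // invfM ler_piMr //.
rewrite invf_le1 ?sqrtr_gt0 ?ltr0n // -[leLHS]sqrtr1 ler_wsqrtr //.
by rewrite ler1n.
Qed.

(** The difference of two such points is the sum of a vector of [V] and of an
    error of l1 norm at most [1/4 + 1/4].  It vanishes on the dominating
    coordinates, so each of its other coordinates is at most [1/2] in absolute
    value, while being [-1], [0] or [1]. *)
Lemma near_cube_inj (R : realType) (n k m : nat) (G : set 'rV[R]_n)
    (p : 'rV[R]_n) (V : {vspace 'rV[R]_n}) (f : 'I_m -> 'I_n) (r : R) :
  affine_subspace k G -> G = [set p + v | v in [set v | v \in V]] ->
  injective f ->
  (forall v, v \in V -> forall j, `|v 0 j| <= \sum_i `|v 0 (f i)|) ->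
  r <= (4 * Num.sqrt n%:R)^-1 -> forall a a',
  cube a -> l2dist a G < r -> cube a' -> l2dist a' G < r ->
  (forall i, a 0 (f i) = a' 0 (f i)) -> a = a'.
Proof.
move=> hG GE f_inj fP hr a a' ca da ca' da' aa'.
have near x : l2dist x G < r ->
    exists2 v, v \in V & \sum_i `|(x - (p + v)) 0 i| <= 4^-1.
  have [b Gb [-> _]] := l2dist_attained x hG => xr.
  move: Gb; rewrite GE => -[v /= vV vE]; exists v => //; rewrite vE.
  apply: le_trans (l1norm_le_l2norm _ _ _) _.
  apply: le_trans (ler_wpM2l (sqrtr_ge0 _) (le_trans (ltW xr) hr)) _.
  rewrite invfM mulrCA -[leRHS]mulr1; apply: ler_wpM2l => //.
  have [->|s0] := eqVneq (Num.sqrt (n%:R : R)) 0; first by rewrite mul0r.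
  by rewrite mulfV.
have [v vV va] := near _ da; have [v' vV' va'] := near _ da'.
apply/rowP => j.
have d1 : `|(a - a') 0 j| < 1.
  apply: (@le_lt_trans _ _ (4^-1 + 4^-1)); last by lra.
  apply: le_trans (coord_le_l1norm_sub _ _ _ f _ (v - v') _ _ _ _) _ => //.
  - by move=> i; rewrite !mxE aa' subrr.
  - by apply: fP; exact: memvB.
  apply: le_trans (lerD va va'); rewrite -big_split /=.
  apply: ler_sum => i _; apply: le_trans (ler_normB _ _).
  by rewrite !mxE le_eqVlt; apply/orP; left; apply/eqP; congr (`|_|); ring.
move: d1; rewrite !mxE.
by case: (ca j) => ->; case: (ca' j) => ->;
  rewrite ?subrr ?subr0 ?sub0r ?normrN ?normr1 ?ltxx.
Qed.

Theorem lemma1p6 (R : realType) (n k : nat) (hk : (0 < k)%N) (hkn : (k < n)%N)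
    (G : set 'rV[R]_n) (hG : affine_subspace k G) :
  [set a | cube a /\
     l2dist a G < 4^-1 * n%:R `^ (- 2^-1) * (n - k)%:R `^ (- 2^-1)]
  #<= `I_(2 ^ k.+1).
Proof.
have [p [V [dimV GE]]] := hG.
have [f f_inj fP] := vspace_dominating_coordinates _ _ V.
have hr : 4^-1 * n%:R `^ (- 2^-1) * (n - k)%:R `^ (- 2^-1) <=
    (4 * Num.sqrt n%:R)^-1 :> R.
  by apply: radius_le; [exact: leq_trans hkn | rewrite subn_gt0].
set B := [set a | _].
pose pattern (a : 'rV[R]_n) := [ffun i => a 0 (f i) == 1].
pose code (a : 'rV[R]_n) : nat := enum_rank (pattern a).
have code_inj : {in B &, injective code}.
  move=> a a' /set_mem[ca da] /set_mem[ca' da'].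
  move=> /ord_inj/enum_rank_inj/ffunP patE.
  apply: (near_cube_inj _ _ _ _ _ _ _ _ _ hG GE f_inj fP hr) => // i.
  move: (patE i); rewrite !ffunE.
  by case: (ca (f i)) => ->; case: (ca' (f i)) => ->;
    rewrite ?eqxx // eq_sym oner_eq0.
have /card_eqPle[_ Bcode] := inj_card_eq code_inj.
apply: card_le_trans Bcode _; apply: subset_card_le => _ [a _ <-] /=.
apply: leq_trans (ltn_ord _) _.
by rewrite card_ffun card_bool card_ord dimV leq_pexp2l.
Qed.
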